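(* Let $\mathbb{H}$ be a real Hilbert space and let $T \in B(\mathbb{H})$. Then the following two conditions are equivalent: (a) for every $A \in B(\mathbb{H})$: $T \perp_B A$ if and only if there exists $x_0 \in M_T$ such that $Tx_0 \perp Ax_0$, i.e. $\langle Tx_0, Ax_0\rangle = 0$; (b) there exists a finite dimensional subspace $H_0$ of $\mathbb{H}$ such that $M_T = S_{H_0}$ and $\|T\|_{H_0^{\perp}} < \|T\|$.
   Context: $B(\mathbb{H})$ is the space of bounded linear operators on $\mathbb{H}$ with the operator norm. $M_T = \{x \in \mathbb{H} : \|x\| = 1, \|Tx\| = \|T\|\}$. For a subspace $H_0$ of $\mathbb{H}$, $S_{H_0} = \{x \in H_0 : \|x\| = 1\}$, $H_0^{\perp}$ is its orthogonal complement, and $\|T\|_{H_0^{\perp}}$ is the norm of the restriction of $T$ to $H_0^{\perp}$, that is, $\sup\{\|Ty\| : y \in H_0^{\perp}, \|y\| = 1\}$ (equal to $0$ if $H_0^{\perp} = \{0\}$). Birkhoff-James orthogonality of operators: $T \perp_B A$ means $\|T\| \le \|T + \lambda A\|$ for all $\lambda \in \mathbb{R}$.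
   Formalization: The formal theorem assumes T is not the zero operator unless H = {0}; for T = 0 on a nonzero H, condition (a) holds but (b) would require a norm to be less than 0, so the equivalence as stated fails exactly there. *)

(* Defs.v *)
From HB Require Import structures.
From mathcomp Require Import all_boot all_order all_algebra.
From mathcomp Require Import boolp classical_sets reals.
From mathcomp Require Import topology normedtype sequences.

Set Implicit Arguments.
Unset Strict Implicit.
Unset Printing Implicit Defensive.

Import Order.TTheory GRing.Theory Num.Theory.
Import numFieldNormedType.Exports.

Local Open Scope classical_set_scope.
Local Open Scope ring_scope.

Section Operators.
Context {R : realType} {H : normedModType R}.
Implicit Types (T A : H -> H) (E : set H).

Definition unit_sphere E : set H := [set x | E x /\ `|x| = 1].

(* These are the operator norms only when the set of values is bounded, i.e.
   for T bounded on E; the supremum of the empty set is 0, so that the norm on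
   the zero subspace is 0. *)
Definition opnorm_on E T : R := sup [set `|T x| | x in unit_sphere E].

Definition opnorm T : R := opnorm_on setT T.

Definition norm_attaining T : set H := [set x | `|x| = 1 /\ `|T x| = opnorm T].

Definition BJ_orthogonal T A : Prop :=
  forall lambda : R, opnorm T <= opnorm (fun x => T x + lambda *: A x).

End Operators.

Section Subspaces.
Context {R : realType} {H : lmodType R}.

Definition linear_span n (e : 'I_n -> H) : set H :=
  [set \sum_(i < n) c i *: e i | c in [set: 'I_n -> R]].

Definition finite_dim_subspace (E : set H) : Prop :=
  submod_closed [in E] /\ exists n (e : 'I_n -> H), E = linear_span e.

Definition orthogonal_complement (dot : {dot H for (@idfun R)}) (E : set H) :
  set H := [set y | forall x, E x -> dot x y = 0].

End Subspaces.

(* Main.v *)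
Require Import Defs.
From mathcomp Require Import all_boot all_order all_algebra.
From mathcomp Require Import boolp classical_sets reals.
From mathcomp Require Import topology normedtype sequences.
From HB Require Import structures.
From mathcomp Require Import interval_inference ring lra.
Import Order.TTheory GRing.Theory Num.Theory.
Import numFieldNormedType.Exports.
Local Open Scope classical_set_scope.
Local Open Scope ring_scope.

(* First-order optimality gives <T u, T v> = |T|^2 <u, v> as soon as
   |T u| = |T| |u|; hence H0 = {u : |T u| = |T| |u|} is a subspace whose unit
   sphere is M_T.

   From (b) to (a): if x |-> <T x, A x> had no zero on the unit sphere of H0,
   it would have a constant sign there, and being a quadratic form on a finite
   dimensional space it would be coercive. Splitting x along H0 and its
   complement and expanding |T x + lambda A x|^2 then yields
   |T + lambda A| < |T| for a small lambda of the right sign.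

   From (a) to (b): A = T D violates (a) whenever <x, D x> > 0 on H0 \ {0} and
   there are unit vectors v with |T v| -> |T| and D v -> 0. If H0 is infinite
   dimensional, take for D the identity minus the diagonal operator with weights
   1 - 1/(k+1) along an orthonormal sequence e_k of H0, with v = e_k. If the norm
   of T on the complement of H0 is |T|, take for D the projection on H0. *)

Set Implicit Arguments.
Unset Strict Implicit.

(** * Symmetric bilinear forms *)

Section SymmetricForms.
Context {R : realType} {V : lmodType R}.
Implicit Types (B : V -> V -> R) (E : set V).

(** A predicate on bare functions, so that it covers both [dot] and the symmetrized form built from
    [T] and [A]. *)
Definition symmetric_bilinear B : Prop :=
  (forall x y, B x y = B y x) /\ (forall z, scalar (B^~ z)).

Definition positive_definite_on E B : Prop :=
  forall x, E x -> x != 0 -> 0 < B x x.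

Section FormTheory.
Variables (B : V -> V -> R) (symB : symmetric_bilinear B).

Lemma sformC x y : B x y = B y x. Proof. exact: symB.1. Qed.

Lemma sformPl a x y z : B (a *: x + y) z = a * B x z + B y z.
Proof. exact: symB.2. Qed.

Lemma sformDl x y z : B (x + y) z = B x z + B y z.
Proof. by rewrite -{1}[x]scale1r sformPl mul1r. Qed.

Lemma sform0l z : B 0 z = 0.
Proof. by apply: (addrI (B 0 z)); rewrite -sformDl !addr0. Qed.

Lemma sformZl a x z : B (a *: x) z = a * B x z.
Proof. by rewrite -[a *: x]addr0 sformPl sform0l addr0. Qed.

Lemma sformBl x y z : B (x - y) z = B x z - B y z.
Proof. by rewrite sformDl -scaleN1r sformZl mulN1r. Qed.

Lemma sform0r z : B z 0 = 0. Proof. by rewrite sformC sform0l. Qed.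
Lemma sformDr x y z : B z (x + y) = B z x + B z y.
Proof. by rewrite !(sformC z) sformDl. Qed.
Lemma sformZr a x z : B z (a *: x) = a * B z x.
Proof. by rewrite !(sformC z) sformZl. Qed.
Lemma sformBr x y z : B z (x - y) = B z x - B z y.
Proof. by rewrite !(sformC z) sformBl. Qed.

Lemma sformNr x z : B z (- x) = - B z x.
Proof. by rewrite -scaleN1r sformZr mulN1r. Qed.

Lemma sform_suml I (r : seq I) (c : I -> R) (e : I -> V) z :
  B (\sum_(i <- r) c i *: e i) z = \sum_(i <- r) c i * B (e i) z.
Proof.
elim/big_ind2: _ => [|x a y b <- <-|i _]; rewrite ?sform0l ?sformDl//.
by rewrite sformZl.
Qed.

End FormTheory.

(** * Finitely generated spans and forms on them *)

Lemma linear_span0 n (e : 'I_n -> V) : linear_span e 0.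
Proof.
by exists (fun=> 0) => //; rewrite big1 // => i _; rewrite scale0r.
Qed.

Lemma linear_spanP n (e : 'I_n -> V) a x y :
  linear_span e x -> linear_span e y -> linear_span e (a *: x + y).
Proof.
move=> [c _ <-] [d _ <-]; exists (fun i => a * c i + d i) => //.
rewrite scaler_sumr -big_split; apply: eq_bigr => i _ /=.
by rewrite scalerDl scalerA.
Qed.

Lemma linear_spanZ n (e : 'I_n -> V) a x :
  linear_span e x -> linear_span e (a *: x).
Proof.
by move=> Ex; rewrite -[_ *: _]addr0; apply: linear_spanP => //; exact: linear_span0.
Qed.

Lemma linear_spanD n (e : 'I_n -> V) x y :
  linear_span e x -> linear_span e y -> linear_span e (x + y).
Proof. by rewrite -{2}[x]scale1r; exact: linear_spanP. Qed.

Lemma linear_spanB n (e : 'I_n -> V) x y :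
  linear_span e x -> linear_span e y -> linear_span e (x - y).
Proof. by move=> Ex Ey; rewrite addrC -scaleN1r; exact: linear_spanP. Qed.

Lemma linear_span_gen n (e : 'I_n -> V) i : linear_span e (e i).
Proof.
exists (fun j => (j == i)%:R) => //.
rewrite (bigD1 i) //= eqxx scale1r big1 ?addr0 // => j /negbTE ->.
by rewrite scale0r.
Qed.

Lemma linear_span_sub n (e : 'I_n -> V) E :
  submod_closed [in E] -> (forall i, E (e i)) -> linear_span e `<=` E.
Proof.
move=> [E0 EP] Ee _ [c _ <-]; rewrite -inE.
elim/big_rec: _ => // i x _ Ex.
by apply: (EP) => //; rewrite inE.
Qed.

(** Peels off one generator, for the inductions on the number of generators. *)
Lemma linear_spanS n (e : 'I_n.+1 -> V) x :
  linear_span e x <->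
  exists t, linear_span (e \o lift ord0) (x - t *: e ord0).
Proof.
split=> [[c _ <-]|[t [c _ xE]]].
  exists (c ord0), (c \o lift ord0) => //.
  by rewrite big_ord_recl addrC addKr.
exists (fun i => if unlift ord0 i is Some j then c j else t) => //.
rewrite big_ord_recl unlift_none /=.
under eq_bigr do rewrite liftK.
by move: xE; rewrite /= => ->; rewrite addrC subrK.
Qed.

(* Gram-Schmidt: subtracting from [e ord0] its projection on the other
   generators reduces to the sum of two B-orthogonal subspaces. *)
Lemma form_projection B n (e : 'I_n -> V) : symmetric_bilinear B ->
  positive_definite_on (linear_span e) B ->
  forall x, exists2 u, linear_span e u &
    forall v, linear_span e v -> B (x - u) v = 0.
Proof.
move=> symB; elim: n e => [|n IHn] e Bpos x.
  exists 0 => [|_ [c _ <-]]; first exact: linear_span0.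
  by rewrite big_ord0 (sform0r symB).
have sub u : linear_span (e \o lift ord0) u -> linear_span e u.
  by move=> Eu; apply/linear_spanS; exists 0; rewrite scale0r subr0.
have proj : forall y, exists2 u, linear_span (e \o lift ord0) u &
    forall v, linear_span (e \o lift ord0) v -> B (y - u) v = 0.
  by apply: IHn => u /sub; exact: Bpos.
have [p Ep pP] := proj (e ord0).
have [u Eu uP] := proj x.
have [f fE] : exists f, f = e ord0 - p by eexists.
rewrite -fE in pP.
have Ef : linear_span e f.
  by rewrite fE; apply: linear_spanB (sub _ Ep); exact: linear_span_gen.
exists (u + (B x f / B f f) *: f).
  by apply: linear_spanD; [exact: sub|exact: linear_spanZ].
move=> v /linear_spanS[t]; set w := v - _ => Ew.
have -> : v = (w + t *: p) + t *: f.
  by rewrite fE scalerBr addrA [w + _ + _]addrAC addrK /w subrK.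
have Ewp : linear_span (e \o lift ord0) (w + t *: p).
  by apply: linear_spanD => //; exact: linear_spanZ.
move: (w + t *: p) Ewp => z Ez.
rewrite opprD addrA (sformBl symB) (sformZl symB) !(sformDr symB, sformZr symB).
rewrite (uP _ Ez) (pP _ Ez) (sformBl symB) (sformC symB u f) (pP _ Eu) subr0 !add0r.
(* [f] vanishes when [e ord0] lies in the span of the other generators; the quotient by [B f f] is
   then harmless because it multiplies 0. *)
have [->|f0] := eqVneq f 0; first by rewrite !(sform0r symB); ring.
by have := Bpos _ Ef f0; move=> ff; field; rewrite gt_eqF.
Qed.

(** If the form were negative at [y] and positive at [x], it would vanish somewhere on the line
    through [x] directed by [y]. The zero is given by the quadratic formula, so no continuity
    argument is involved. *)
Lemma form_definite_sign B E : symmetric_bilinear B -> submod_closed [in E] ->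
  (forall x, E x -> x != 0 -> B x x != 0) ->
  positive_definite_on E B \/ positive_definite_on E (fun x y => - B x y).
Proof.
move=> symB [_ EP] Bne0.
have [|] := pselect (positive_definite_on E B); first by left.
move=> /existsNP[y /not_implyP[Ey /not_implyP[y0 /negP]]].
rewrite -real_leNgt ?num_real // le_eqVlt (negbTE (Bne0 _ Ey y0)) /= => By.
right=> x Ex x0; rewrite oppr_gt0 real_ltNge ?num_real //; apply/negP.
rewrite le_eqVlt eq_sym (negbTE (Bne0 _ Ex x0)) /= => Bx.
(* [t] is a root of the quadratic polynomial [B (x + t y) (x + t y)]. *)
pose D := B x y ^+ 2 - B x x * B y y.
have D0 : 0 <= D by rewrite /D; nra.
pose t := (- B x y + Num.sqrt D) / B y y.
have sD : Num.sqrt D ^+ 2 = D by exact: sqr_sqrtr.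
have E1 : E (t *: y + x).
  by have := EP t y x; rewrite !inE; apply.
have [z0|z0] := eqVneq (t *: y + x) 0.
  have := Bx; have -> : x = (- t) *: y by rewrite -[x](addKr (t *: y)) z0 addr0 scaleNr.
  rewrite sformZl // sformZr //.
  have := sqr_ge0 t; nra.
have := Bne0 _ E1 z0.
rewrite !(sformDl symB, sformDr symB, sformZl symB, sformZr symB) (sformC symB y x).
have -> : t * (t * B y y) + t * B x y + (t * B x y + B x x) =
   (Num.sqrt D ^+ 2 - D) / B y y.
  rewrite /t /D; field; by rewrite lt_eqF.
by rewrite sD subrr mul0r eqxx.
Qed.

End SymmetricForms.

(** Induction on the generators replaces compactness of the sphere: a vector splits as [z + t *: f]
    with [z] and [f] orthogonal for [B], and the constants for the two pieces are combined. The norm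
    need not come from [B], so the pieces are joined by the triangle inequality, whose square costs
    the factor 2 in [Num.min c d / 2]. *)
Lemma form_coercive {R : realType} {H : normedModType R} (B : H -> H -> R) n
    (e : 'I_n -> H) : symmetric_bilinear B ->
  positive_definite_on (linear_span e) B ->
  exists2 c, 0 < c & forall u, linear_span e u -> c * `|u| ^+ 2 <= B u u.
Proof.
move=> symB; elim: n e => [|n IHn] e Bpos.
  exists 1 => // _ [c _ <-].
  by rewrite big_ord0 (sform0r symB) normr0 expr0n mulr0.
have sub u : linear_span (e \o lift ord0) u -> linear_span e u.
  by move=> Eu; apply/linear_spanS; exists 0; rewrite scale0r subr0.
have Bpos' : positive_definite_on (linear_span (e \o lift ord0)) B.
  by move=> u /sub; exact: Bpos.
have [c c0 cP] := IHn _ Bpos'.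
have [p Ep pP] := form_projection symB Bpos' (e ord0).
have [f fE] : exists f, f = e ord0 - p by eexists.
rewrite -fE in pP.
have Ef : linear_span e f.
  by rewrite fE; apply: linear_spanB (sub _ Ep); exact: linear_span_gen.
have [d d0 dP] : exists2 d, 0 < d & d * `|f| ^+ 2 <= B f f.
  have [->|f0] := eqVneq f 0.
    by exists 1 => //; rewrite (sform0r symB) normr0 expr0n mulr0.
  have f2 : 0 < `|f| ^+ 2 by rewrite exprn_gt0 // normr_gt0.
  exists (B f f / `|f| ^+ 2); first by rewrite divr_gt0 // Bpos.
  by rewrite divfK // gt_eqF.
exists (Num.min c d / 2) => [|v /linear_spanS[t]].
  by rewrite divr_gt0 // lt_min c0.
set w := v - _ => Ew.
have -> : v = (w + t *: p) + t *: f.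
  by rewrite fE scalerBr addrA [w + _ + _]addrAC addrK /w subrK.
have Ewp : linear_span (e \o lift ord0) (w + t *: p).
  by apply: linear_spanD => //; exact: linear_spanZ.
move: (w + t *: p) Ewp => z Ez.
rewrite !(sformDl symB, sformDr symB, sformZl symB, sformZr symB).
rewrite (sformC symB z f) (pP _ Ez) mulr0 addr0 add0r.
have nz : `|z + t *: f| ^+ 2 <= 2 * (`|z| ^+ 2 + t ^+ 2 * `|f| ^+ 2).
  have h : `|z + t *: f| <= `|z| + `|t| * `|f| by rewrite -normrZ; exact: ler_normD.
  rewrite -[t ^+ 2]real_normK ?num_real //.
  apply: (le_trans (y := (`|z| + `|t| * `|f|) ^+ 2)).
    by rewrite lerXn2r ?nnegrE // addr_ge0 // mulr_ge0.
  have := sqr_ge0 (`|z| - `|t| * `|f|); nra.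
have mc : Num.min c d <= c by rewrite ge_min lexx.
have md : Num.min c d <= d by rewrite ge_min lexx orbT.
have m0 : 0 < Num.min c d by rewrite lt_min c0.
have := cP _ Ez; have := sqr_ge0 t.
move: (Num.min c d) mc md m0 => m mc md m0 t2 cz.
have h1 : m * `|z| ^+ 2 <= B z z by apply: le_trans cz; rewrite ler_wpM2r ?sqr_ge0.
have h2 : m * `|f| ^+ 2 <= B f f by apply: le_trans dP; rewrite ler_wpM2r ?sqr_ge0.
have h3 : t ^+ 2 * (m * `|f| ^+ 2) <= t ^+ 2 * B f f by rewrite ler_wpM2l.
have h4 : m / 2 * `|z + t *: f| ^+ 2 <= m / 2 * (2 * (`|z| ^+ 2 + t ^+ 2 * `|f| ^+ 2)).
  by rewrite ler_wpM2l // divr_ge0 // ltW.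
apply: le_trans h4 _; rewrite mulrA -expr2; lra.
Qed.

(** * Operator norms as suprema over unit spheres *)

Section OperatorNorm.
Context {R : realType} {H : normedModType R}.
Implicit Types (E : set H) (f : H -> H) (T : {linear H -> H}).

Definition norm_bounded_by K f : Prop := forall x, `|f x| <= K * `|x|.

Lemma unit_normalize (x : H) : x != 0 -> `| `|x|^-1 *: x | = 1.
Proof.
move=> x0; rewrite normrZ normfV normr_id mulVf //.
by rewrite normr_eq0.
Qed.

Lemma bounded_linear_norm_bounded T : bounded_fun_norm T ->
  exists2 K, 1 <= K & norm_bounded_by K T.
Proof.
(* The bound on the unit ball extends by homogeneity; the maximum with 1 makes the constant
   positive. *)
move=> /(_ 1)[K KP]; exists (Num.max 1 K); first by rewrite le_max lexx.
move=> x; have [->|x0] := eqVneq x 0; first by rewrite linear0 !normr0 mulr0.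
rewrite -ler_pdivrMr ?normr_gt0 // mulrC -[X in X * _]gtr0_norm ?invr_gt0 ?normr_gt0 //.
rewrite -normrZ -linearZ le_max KP ?orbT //.
by rewrite unit_normalize.
Qed.

Lemma norm_bounded_by_fun_norm K f : 0 <= K ->
  norm_bounded_by K f -> bounded_fun_norm f.
Proof.
move=> K0 fK r; exists (K * r) => x xr.
by apply: le_trans (fK x) _; rewrite ler_wpM2l.
Qed.

Lemma norm_bounded_by_addZ K L f g (a : R) :
  norm_bounded_by K f -> norm_bounded_by L g ->
  norm_bounded_by (K + `|a| * L) (fun x => f x + a *: g x).
Proof.
move=> fK gL x; apply: le_trans (ler_normD _ _) _.
by rewrite normrZ mulrDl lerD // -mulrA ler_wpM2l.
Qed.

Lemma opnorm_on_ge K E f x : norm_bounded_by K f -> E x -> `|x| = 1 ->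
  `|f x| <= opnorm_on E f.
Proof.
move=> fK Ex x1; apply: ub_le_sup; last by exists x.
exists K => _ [y [_ y1] <-].
by have := fK y; rewrite y1 mulr1.
Qed.

Lemma opnorm_on_le E f k : 0 <= k ->
  (forall x, E x -> `|x| = 1 -> `|f x| <= k) -> opnorm_on E f <= k.
Proof.
move=> k0 fk.
have [S0|S0] := pselect ([set `|f x| | x in unit_sphere E] !=set0).
  by apply: ge_sup => // _ [y [Ey y1] <-]; exact: fk.
by rewrite /opnorm_on (_ : [set _ | _ in _] = set0) ?sup0 //; apply/nonemptyPn.
Qed.

Lemma opnorm_on_approx E f k : 0 < opnorm_on E f -> k < opnorm_on E f ->
  exists x, [/\ E x, `|x| = 1 & k < `|f x|].
Proof.
move=> f0 fk; apply: contrapT => /forallNP nx.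
(* [k] may be negative, while an upper bound for [opnorm_on] has to be nonnegative to cover an empty
   sphere, where the supremum is 0. *)
have : opnorm_on E f <= Num.max 0 k.
  apply: opnorm_on_le => [|x Ex x1]; first by rewrite le_max lexx.
  rewrite le_max [_ <= k]real_leNgt ?num_real //; apply/orP; right.
  by apply/negP => kx; exact: (nx x).
by rewrite leNgt gt_max f0 fk.
Qed.

Lemma opnorm_on_ge0 E f : 0 <= opnorm_on E f.
Proof.
have [hs|/sup_out hs] := pselect (has_sup [set `|f x| | x in unit_sphere E]).
  have [_ [x Ex _]] := hs.1; apply: le_trans (normr_ge0 (f x)) _.
  by apply: ub_le_sup; [exact: hs.2|exists x].
by rewrite /opnorm_on hs.
Qed.

Lemma opnorm_on_bound K E T x : norm_bounded_by K T ->
  (forall a y, E y -> E (a *: y)) -> E x -> `|T x| <= opnorm_on E T * `|x|.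
Proof.
move=> TK EZ Ex.
have [->|x0] := eqVneq x 0; first by rewrite linear0 !normr0 mulr0.
rewrite -ler_pdivrMr ?normr_gt0 // mulrC -[X in X * _]gtr0_norm ?invr_gt0 ?normr_gt0 //.
rewrite -normrZ -linearZ; apply: (opnorm_on_ge TK); first exact: EZ.
exact: unit_normalize.
Qed.

Lemma opnorm_bound K T x : norm_bounded_by K T -> `|T x| <= opnorm T * `|x|.
Proof. by move=> TK; exact: (opnorm_on_bound TK). Qed.

Lemma norm_attaining_normalize K T x : norm_bounded_by K T ->
  x != 0 -> `|T x| = opnorm T * `|x| -> norm_attaining T (`|x|^-1 *: x).
Proof.
move=> TK x0 Tx; split; first exact: unit_normalize.
rewrite linearZ normrZ normfV normr_id Tx mulrC mulfK //.
by rewrite normr_eq0.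
Qed.

Lemma pack_linear (f : H -> H) : linear f ->
  exists g : {linear H -> H}, (g : H -> H) = f.
Proof.
move=> fL; pose F := GRing.isLinear.Build R H H *:%R f fL.
by exists (HB.pack_for {linear H -> H} f F).
Qed.

End OperatorNorm.

(** * Elementary inner product identities and Cauchy-Schwarz *)

Section InnerProduct.
Context {R : realType} {H : normedModType R}.
Variables (dot : {dot H for (@idfun R)}).
Hypothesis dot_norm : forall x : H, dot x x = `|x| ^+ 2.

Lemma dot_symmetric_bilinear : symmetric_bilinear dot.
Proof.
split=> [x y|z a x y].
  (* Hermitian symmetry for the conjugation [idfun], with sign $(-1)^0$, is plain symmetry. *)
  rewrite (@hermC _ _ (GRing.RMorphism.clone R R idfun _) _ dot).
  by rewrite expr0 mul1r.
by rewrite linearDl linearZl_LR.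
Qed.
Let dotS := dot_symmetric_bilinear.

Lemma dot_pos (x : H) : x != 0 -> 0 < dot x x.
Proof. by move=> x0; rewrite dot_norm exprn_gt0 // normr_gt0. Qed.

Lemma norm_addZ_sqr (x y : H) t :
  `|x + t *: y| ^+ 2 = `|x| ^+ 2 + 2 * t * dot x y + t ^+ 2 * `|y| ^+ 2.
Proof.
rewrite -!dot_norm !(sformDl dotS, sformDr dotS, sformZl dotS, sformZr dotS).
by rewrite (sformC dotS y x); ring.
Qed.

Lemma norm_add_sqr (x y : H) :
  `|x + y| ^+ 2 = `|x| ^+ 2 + 2 * dot x y + `|y| ^+ 2.
Proof. by rewrite -[y]scale1r norm_addZ_sqr scale1r; ring. Qed.

Lemma Cauchy_Schwarz (x y : H) : `|dot x y| <= `|x| * `|y|.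
Proof.
have [->|y0] := eqVneq y 0; first by rewrite (sform0r dotS) !normr0 mulr0.
have yy : 0 < `|y| ^+ 2 by rewrite exprn_gt0 // normr_gt0.
rewrite -[_ <= _](@ler_pXn2r _ 2) ?nnegrE ?mulr_ge0 //.
rewrite real_normK ?num_real // exprMn -subr_ge0.
rewrite -(pmulr_lge0 _ yy).
(* This squared norm equals $|y|^2 (|x|^2 |y|^2 - \langle x, y\rangle^2)$. *)
have := sqr_ge0 `|(`|y| ^+ 2) *: x + (- dot x y) *: y|.
rewrite norm_addZ_sqr normrZ exprMn (sformZl dotS) ger0_norm ?sqr_ge0 //.
move=> h; nra.
Qed.

End InnerProduct.

(** At [t = p / s] with [s = |k| + 1], the inequality reads [s * t ^+ 2 <= k * t ^+ 2], which forces
    [t = 0] since [k < s]. *)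
Lemma linear_le_quadratic_eq0 {R : realType} (p k : R) :
  (forall t, t * p <= t ^+ 2 * k) -> p = 0.
Proof.
pose s := `|k| + 1; have s0 : 0 < s by rewrite ltr_pwDr.
move=> /(_ (p / s)); have -> : p / s * p = s * (p / s) ^+ 2.
  by field; rewrite gt_eqF.
have [->//|p0] := eqVneq p 0.
have q0 : 0 < (p / s) ^+ 2.
  by rewrite exprn_even_gt0 //= mulf_neq0 // invr_eq0 gt_eqF.
rewrite mulrC ler_pM2l // => sk.
by have := ler_norm k; rewrite /s in sk; lra.
Qed.

(** * Decreasing the operator norm by a perturbation *)

Section Descent.
Context {R : realType} {H : normedModType R}.
Variables (dot : {dot H for (@idfun R)}).
Hypothesis dot_norm : forall x : H, dot x x = `|x| ^+ 2.
Let dotS := dot_symmetric_bilinear dot.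

(* First-order optimality of [u] for [|T (u + t v)|^2 <= M^2 |u + t v|^2]:
   the vector [u] satisfies [T^* T u = M^2 u]. *)
Lemma norm_max_dot (T : {linear H -> H}) M u v : 0 <= M ->
  norm_bounded_by M T -> `|T u| = M * `|u| ->
  dot (T u) (T v) = M ^+ 2 * dot u v.
Proof.
move=> M0 TM Tu.
suff : 2 * (dot (T u) (T v) - M ^+ 2 * dot u v) = 0 by lra.
apply: (@linear_le_quadratic_eq0 _ _ (M ^+ 2 * `|v| ^+ 2 - `|T v| ^+ 2)) => t.
have : `|T (u + t *: v)| ^+ 2 <= (M * `|u + t *: v|) ^+ 2.
  by rewrite lerXn2r ?nnegrE ?mulr_ge0.
rewrite exprMn linearD linearZ /= !(norm_addZ_sqr dot_norm) Tu.
by rewrite exprMn; lra.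
Qed.

Lemma dot_projection n (e : 'I_n -> H) x : exists2 u, linear_span e u &
  orthogonal_complement dot (linear_span e) (x - u).
Proof.
have [|u Eu uP] := @form_projection _ _ dot n e dotS _ x.
  by move=> y _; exact: dot_pos.
by exists u => // v Ev; rewrite (sformC dotS) uP.
Qed.

(** On the diagonal this form is twice [dot (T x) (A x)]. *)
Lemma symmetrized_bilinear (T A : {linear H -> H}) :
  symmetric_bilinear (fun x y => dot (T x) (A y) + dot (T y) (A x)).
Proof.
split=> [x y|z a x y]; first by rewrite addrC.
rewrite !linearP /= !(sformDl dotS, sformDr dotS, sformZl dotS, sformZr dotS).
by ring.
Qed.

(** For a unit vector [x = u + v] split along the span, [norm_max_dot] makes [T u] and [T v]
    orthogonal. Subtracting [t *: A x] lowers the [u] part by coercivity, while the gap between [m]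
    and [opnorm T] absorbs the first-order loss on the [v] part. *)
Lemma opnorm_descent (T A : {linear H -> H}) n (e : 'I_n -> H) K L m :
  norm_bounded_by K T -> norm_bounded_by L A -> 1 <= L ->
  (forall u, linear_span e u -> `|T u| = opnorm T * `|u|) ->
  (forall v, orthogonal_complement dot (linear_span e) v ->
     `|T v| <= m * `|v|) ->
  0 <= m < opnorm T ->
  positive_definite_on (linear_span e)
    (fun x y => dot (T x) (A y) + dot (T y) (A x)) ->
  exists lambda, opnorm (fun x => T x + lambda *: A x) < opnorm T.
Proof.
move=> TK AL L1 Te Tm /andP[m0 mM] Bpos.
have TM : norm_bounded_by (opnorm T) T by move=> x; exact: opnorm_bound TK.
move: (opnorm T) TM Te mM => M TM Te mM.
have [c0 c00 c0P] := form_coercive (symmetrized_bilinear T A) Bpos.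
pose c := c0 / 2.
have cP u : linear_span e u -> c * `|u| ^+ 2 <= dot (T u) (A u).
  by move=> /c0P; rewrite /c; lra.
have cgt0 : 0 < c by rewrite /c; lra.
clearbody c.
(* [Q] collects the costs charged to $|v|^2$: the cross terms after AM-GM, the term
   [dot (T v) (A v)], and the second-order term. *)
pose N := M * L; pose Q := 4 * N ^+ 2 / c + 2 * N + L ^+ 2.
have M0 : 0 < M by lra.
have L0 : 0 < L by lra.
have N0 : 0 < N by rewrite mulr_gt0.
have L20 : 0 < L ^+ 2 by rewrite exprn_gt0.
have Q0 : 0 < Q.
  by rewrite /Q ltr_wpDl // addr_ge0 ?divr_ge0 ?mulr_ge0 ?exprn_ge0 // ltW.
have [d dE] : exists d, d = (M ^+ 2 - m ^+ 2) / 2 by eexists.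
have d0 : 0 < d by rewrite dE divr_gt0 // subr_gt0 ltrXn2r // ltW.
(* The second bound keeps the second-order term below half of the gain on [u]; the third keeps the
   cost on [v] below [d], half of the gap between the squares; [t <= 1] gives $t^2 \le t$. *)
pose t := Num.min 1 (Num.min (c / (2 * L ^+ 2)) (d / Q)).
have t0 : 0 < t by rewrite /t !lt_min ltr01 !divr_gt0 ?mulr_gt0 //.
have t1 : t <= 1 by rewrite /t !ge_min lexx.
have tc : t * L ^+ 2 <= c / 2.
  have : t <= c / (2 * L ^+ 2) by rewrite /t !ge_min lexx !orbT.
  by rewrite ler_pdivlMr; lra.
have tQ : t * Q <= d by rewrite -ler_pdivlMr // /t !ge_min lexx !orbT.
clearbody t.
(* The two entries bound the coefficients of $|u|^2$ and $|v|^2$; as these squares add up to 1, [r]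
   bounds the squared norm of the image. Note that [m ^+ 2 + d = M ^+ 2 - d]. *)
pose r := Num.max (M ^+ 2 - t * (c / 2)) (M ^+ 2 - d).
have rM : r < M ^+ 2.
  by rewrite /r gt_max; apply/andP; split; have := mulr_gt0 t0 cgt0; lra.
have r1 : M ^+ 2 - t * (c / 2) <= r by rewrite /r le_max lexx.
have r2 : M ^+ 2 - d <= r by rewrite /r le_max lexx orbT.
have r0 : 0 <= r.
  by apply: le_trans r2; rewrite dE; have := sqr_ge0 m; have := sqr_ge0 M; lra.
clearbody r.
exists (- t); apply: (@le_lt_trans _ _ (Num.sqrt r)); last first.
  by rewrite -[M]gtr0_norm // -sqrtr_sqr ltr_sqrt // exprn_gt0.
apply: opnorm_on_le => [|x _ x1]; first exact: sqrtr_ge0.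
rewrite -[leLHS]ger0_norm // -sqrtr_sqr ler_sqrt //.
have [u Eu uP] := dot_projection e x.
have [v vE] : exists v, v = x - u by eexists.
rewrite -vE in uP.
have xE : x = u + v by rewrite vE addrC subrK.
have uv : dot u v = 0 by exact: uP.
have TuTv : dot (T u) (T v) = 0.
  by rewrite (norm_max_dot _ (ltW M0) TM (Te _ Eu)) uv mulr0.
have CS y z : `|dot (T y) (A z)| <= N * `|y| * `|z|.
  apply: le_trans (Cauchy_Schwarz dot_norm _ _) _.
  apply: le_trans (ler_pM _ _ (TM y) (AL z)) _ => //.
  by rewrite mulrACA -/N mulrA.
have ab : `|u| ^+ 2 + `|v| ^+ 2 = 1.
  have := norm_add_sqr dot_norm u v.
  by rewrite -xE x1 uv expr1n mulr0 addr0.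
have Tx : `|T x| ^+ 2 = M ^+ 2 * `|u| ^+ 2 + `|T v| ^+ 2.
  by rewrite xE linearD /= (norm_add_sqr dot_norm) TuTv Te // exprMn; ring.
have Tv : `|T v| ^+ 2 <= m ^+ 2 * `|v| ^+ 2.
  by rewrite -exprMn lerXn2r ?nnegrE ?mulr_ge0 // Tm.
have Ax : `|A x| ^+ 2 <= L ^+ 2.
  by have := AL x; rewrite x1 mulr1 => Ax; rewrite lerXn2r ?nnegrE // ltW.
rewrite (norm_addZ_sqr dot_norm) Tx.
have -> : dot (T x) (A x) = dot (T (u + v)) (A (u + v)) by rewrite -xE.
rewrite !linearD /= !(sformDl dotS, sformDr dotS).
have h1 : c * `|u| ^+ 2 <= dot (T u) (A u) := cP _ Eu.
have h2 : - (N * `|u| * `|v|) <= dot (T u) (A v)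
  by have := CS u v; rewrite ler_norml => /andP[].
have h3 : - (N * `|v| * `|u|) <= dot (T v) (A u)
  by have := CS v u; rewrite ler_norml => /andP[].
have h4 : - (N * `|v| * `|v|) <= dot (T v) (A v)
  by have := CS v v; rewrite ler_norml => /andP[].
set a := `|u| in h1 h2 h3 h4 ab *; set b := `|v| in h2 h3 h4 ab Tv *.
have AMGM : 4 * (N * a * b) <= c * a ^+ 2 + 4 * N ^+ 2 / c * b ^+ 2.
  rewrite -subr_ge0; have -> : c * a ^+ 2 + 4 * N ^+ 2 / c * b ^+ 2 - 4 * (N * a * b)
    = (c * a - 2 * N * b) ^+ 2 / c by field; rewrite gt_eqF.
  by rewrite divr_ge0 ?sqr_ge0 // ltW.
set W := _ + _ + (_ + _).
have hW : - (2 * W) <= - c * a ^+ 2 + (Q - L ^+ 2) * b ^+ 2.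
  by rewrite /W /Q; lra.
clearbody W a b.
have a2 := sqr_ge0 a; have b2 := sqr_ge0 b.
have g1 : t * - (2 * W) <= t * (- c * a ^+ 2 + (Q - L ^+ 2) * b ^+ 2).
  by rewrite ler_pM2l.
have g2 : t ^+ 2 * `|A x| ^+ 2 <= t ^+ 2 * L ^+ 2 by rewrite ler_wpM2l ?sqr_ge0.
have g3 : t * L ^+ 2 * (t * a ^+ 2) <= c / 2 * (t * a ^+ 2).
  by apply: ler_wpM2r => //; apply: mulr_ge0 => //; exact: ltW.
have g4 : t * (t * L ^+ 2 * b ^+ 2) <= t * L ^+ 2 * b ^+ 2.
  by apply: ler_piMl => //; apply: mulr_ge0 => //; apply: mulr_ge0; exact: ltW.
have g5 : t * Q * b ^+ 2 <= d * b ^+ 2 by rewrite ler_wpM2r.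
have g6 : (M ^+ 2 - t * (c / 2)) * a ^+ 2 <= r * a ^+ 2 by rewrite ler_wpM2r.
have g7 : (M ^+ 2 - d) * b ^+ 2 <= r * b ^+ 2 by rewrite ler_wpM2r.
have g8 : d * b ^+ 2 = (M ^+ 2 * b ^+ 2 - m ^+ 2 * b ^+ 2) / 2 by rewrite dE; lra.
have g9 : r * a ^+ 2 + r * b ^+ 2 = r by rewrite -mulrDr ab mulr1.
have g10 : t ^+ 2 * L ^+ 2 = t * L ^+ 2 * (t * a ^+ 2) + t * (t * L ^+ 2 * b ^+ 2).
  by rewrite -[LHS]mulr1 -ab; ring.
lra.
Qed.

End Descent.

(** * Diagonal operators along an orthonormal sequence *)

Section Bessel.
Context {R : realType} {H : completeNormedModType R}.
Variables (dot : {dot H for (@idfun R)}).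
Hypothesis dot_norm : forall x : H, dot x x = `|x| ^+ 2.
Let dotS := dot_symmetric_bilinear dot.

Variable e : nat -> H.
Hypothesis e_orthonormal : forall i j, dot (e i) (e j) = (i == j)%:R.

Lemma orthonormal_coef (c : nat -> R) (r : seq nat) k : uniq r -> k \in r ->
  dot (e k) (\sum_(j <- r) c j *: e j) = c k.
Proof.
move=> ur kr; rewrite (sformC dotS) (sform_suml dotS) (bigD1_seq k) //=.
rewrite e_orthonormal eqxx mulr1 big1 ?addr0 // => j /negbTE jk.
by rewrite e_orthonormal jk mulr0.
Qed.

Lemma orthonormal_norm_sqr (c : nat -> R) (r : seq nat) : uniq r ->
  `|\sum_(j <- r) c j *: e j| ^+ 2 = \sum_(j <- r) c j ^+ 2.
Proof.
move=> ur; rewrite -dot_norm (sform_suml dotS) [LHS]big_seq [RHS]big_seq.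
by apply: eq_bigr => k kr; rewrite orthonormal_coef.
Qed.

Lemma Bessel_inequality x (r : seq nat) : uniq r ->
  \sum_(j <- r) dot (e j) x ^+ 2 <= `|x| ^+ 2.
Proof.
move=> ur; pose p := \sum_(j <- r) dot (e j) x *: e j.
have := sqr_ge0 `|x + (-1) *: p|.
rewrite (norm_addZ_sqr dot_norm) {2}/p orthonormal_norm_sqr //.
have -> : dot x p = \sum_(j <- r) dot (e j) x ^+ 2.
  by rewrite (sformC dotS) (sform_suml dotS).
by lra.
Qed.

Variable a : nat -> R.
Hypothesis a01 : forall k, 0 <= a k < 1.

Let term x k := (a k * dot (e k) x) *: e k.

Let weight_sqr_le x k : (a k * dot (e k) x) ^+ 2 <= dot (e k) x ^+ 2.
Proof.
have /andP[ak0 ak1] := a01 k.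
by rewrite exprMn ler_piMl ?sqr_ge0 // exprn_ile1 // ltW.
Qed.

(** By orthonormality and [a k < 1], the squared norm of a block of terms is at most the same block
    of the Bessel series, which converges; completeness of [H] concludes. *)
Lemma diagonal_series_cvg x : cvgn (series (term x)).
Proof.
apply/cauchy_cvgP/cauchy_seriesP => eps eps0.
have : cvgn (series (fun k => dot (e k) x ^+ 2)).
  apply: nondecreasing_is_cvgn.
    by apply: nondecreasing_series => k _ _; exact: sqr_ge0.
  exists (`|x| ^+ 2) => _ [n _ <-].
  by apply: Bessel_inequality; rewrite iota_uniq.
move=> /cvg_cauchy/cauchy_seriesP/(_ (eps ^+ 2)).
rewrite exprn_gt0 // => /(_ isT); apply: filterS => -[m n] /= h.
rewrite -(@ltr_pXn2r _ 2) ?nnegrE // ?ltW //.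
rewrite orthonormal_norm_sqr ?iota_uniq //.
apply: le_lt_trans h; rewrite ger0_norm; last by apply: sumr_ge0 => *; exact: sqr_ge0.
by apply: ler_sum => k _; exact: weight_sqr_le.
Qed.

Let S x := limn (series (term x)).

Lemma diagonal_series_lim x : series (term x) @ \oo --> S x.
Proof. exact: diagonal_series_cvg. Qed.

Lemma diagonal_series_linear : linear S.
Proof.
move=> c x y; apply/cvg_lim => //.
have -> : series (term (c *: x + y)) =
    (fun n => c *: series (term x) n + series (term y) n).
  apply/funext => n; rewrite /series /= scaler_sumr -big_split.
  apply: eq_bigr => k _ /=.
  rewrite /term linearP /= mulrDr scalerDl scalerA.
  by congr (_ *: _ + _); ring.
by apply: cvgD; [apply: cvgZl_tmp|]; exact: diagonal_series_lim.
Qed.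

Lemma diagonal_series_norm : norm_bounded_by 1 S.
Proof.
move=> x; rewrite mul1r.
apply: (cvgr_to_le (cvg_norm (diagonal_series_lim (x := x)))).
apply: nearW => n.
rewrite -(@ler_pXn2r _ 2) ?nnegrE //.
rewrite orthonormal_norm_sqr ?iota_uniq //.
apply: le_trans (Bessel_inequality x (iota_uniq 0 n)).
by rewrite /index_iota subn0; apply: ler_sum => k _; exact: weight_sqr_le.
Qed.

Lemma diagonal_series_basis k : S (e k) = a k *: e k.
Proof.
apply/cvg_lim => //; apply: cvg_near_cst.
near=> n; have kn : (k < n)%N by near: n; exact: nbhs_infty_gt.
rewrite /series /= (bigD1_seq k) ?iota_uniq ?mem_index_iota //=.
rewrite /term e_orthonormal eqxx mulr1 big1 ?addr0 // => j /negbTE jk.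
by rewrite e_orthonormal jk mulr0 scale0r.
Unshelve. all: by end_near. Qed.

Lemma cvg_dot x (u : nat -> H) l : u @ \oo --> l ->
  dot x (u n) @[n --> \oo] --> dot x l.
Proof.
move=> /cvgrPdist_lt ul; apply/cvgrPdist_lt => eps eps0.
have x0 : 0 < `|x| + 1 by rewrite ltr_pwDr.
have := ul (eps / (`|x| + 1)); rewrite divr_gt0 // => /(_ isT).
apply: filterS => n; rewrite ltr_pdivlMr // => h.
rewrite -(sformBr dotS); apply: le_lt_trans (Cauchy_Schwarz dot_norm _ _) _.
apply: le_lt_trans h; rewrite mulrC ler_wpM2l //.
by rewrite lerDl.
Qed.

(** Strictness must survive the limit: a single index [k] with a nonzero coefficient leaves the
    fixed gap [(1 - a k) * dot (e k) x ^+ 2] in all late partial sums. If every coefficient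
    vanishes, then [S x = 0]. *)
Lemma diagonal_series_lt x : x != 0 -> dot x (S x) < `|x| ^+ 2.
Proof.
move=> x0; have x2 : 0 < `|x| ^+ 2 by rewrite exprn_gt0 // normr_gt0.
have [[k ck]|allc] := pselect (exists k, dot (e k) x != 0); last first.
  suff -> : S x = 0 by rewrite (sform0r dotS).
  apply/cvg_lim => //; apply: cvg_near_cst; apply: nearW => n.
  rewrite /series /= big1 // => k _.
  have [c0|c0] := eqVneq (dot (e k) x) 0; first by rewrite /term c0 mulr0 scale0r.
  by exfalso; apply: allc; exists k.
have /andP[ak0 ak1] := a01 k.
have pos : 0 < (1 - a k) * dot (e k) x ^+ 2.
  by rewrite mulr_gt0 ?subr_gt0 // exprn_even_gt0.
apply: (@le_lt_trans _ _ (`|x| ^+ 2 - (1 - a k) * dot (e k) x ^+ 2)); last by lra.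
apply: (cvgr_to_le (cvg_dot (x := x) (diagonal_series_lim (x := x)))).
near=> n; have kn : (k < n)%N by near: n; exact: nbhs_infty_gt.
have := Bessel_inequality x (iota_uniq 0 n).
rewrite (sformC dotS) /series /= (sform_suml dotS) /index_iota subn0.
have kin : k \in iota 0 n by rewrite mem_iota.
rewrite !(bigD1_seq k) ?iota_uniq //=.
have : \sum_(i <- iota 0 n | i != k) a i * dot (e i) x * dot (e i) x <=
   \sum_(i <- iota 0 n | i != k) dot (e i) x ^+ 2.
  apply: ler_sum => i _; have /andP[ai0 ai1] := a01 i.
  by rewrite -mulrA -expr2 ler_piMl ?sqr_ge0 // ltW.
by lra.
Unshelve. all: by end_near. Qed.

Lemma diagonal_operator : exists D : {linear H -> H},
  [/\ norm_bounded_by 2 D, forall k, D (e k) = (1 - a k) *: e k &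
      forall x, x != 0 -> 0 < dot x (D x)].
Proof.
have [D DE] : exists D : {linear H -> H}, (D : H -> H) = fun x => x - S x.
  apply: pack_linear => c x y; rewrite diagonal_series_linear.
  by rewrite scalerBr opprD addrACA.
exists D; rewrite DE; split=> [x|k|x x0].
- apply: le_trans (ler_normB _ _) _.
  by have := diagonal_series_norm x; lra.
- by rewrite diagonal_series_basis scalerBl scale1r.
- by rewrite (sformBr dotS) dot_norm subr_gt0 diagonal_series_lt.
Qed.

End Bessel.

(** * Orthonormal sequences and orthogonal projections *)

Section Subspaces.
Context {R : realType} {H : normedModType R}.
Variables (dot : {dot H for (@idfun R)}).
Hypothesis dot_norm : forall x : H, dot x x = `|x| ^+ 2.
Let dotS := dot_symmetric_bilinear dot.

Lemma infinite_dim_orthonormal (E : set H) : submod_closed [in E] ->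
  ~ finite_dim_subspace E -> exists e : nat -> H,
    (forall k, E (e k)) /\ forall i j, dot (e i) (e j) = (i == j)%:R.
Proof.
move=> Esub Einf.
(* The condition on [s] sits under the existential so that choice yields a function on all lists. *)
have next (s : seq H) : exists y, (forall z, z \in s -> E z) ->
    [/\ E y, `|y| = 1 & forall z, z \in s -> dot y z = 0].
  have [sE|] := pselect (forall z, z \in s -> E z); last by exists 0.
  pose f (i : 'I_(size s)) := nth 0 s i.
  have fE : linear_span f `<=` E.
    by apply: linear_span_sub => // i; apply: sE; exact: mem_nth.
  have [x [Ex nx]] : exists x, E x /\ ~ linear_span f x.
    apply: contrapT => nx; apply: Einf; split=> //; exists (size s), f.
    apply/seteqP; split=> // x Ex; apply: contrapT => fx; apply: nx.
    by exists x.
  have [u fu uP] := dot_projection dot_norm f x.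
  have xu0 : x - u != 0.
    by rewrite subr_eq0; apply/eqP => xu; apply: nx; rewrite xu.
  exists (`|x - u|^-1 *: (x - u)) => _; split.
  - have [E0 EP] := Esub; rewrite inE in E0.
    have EP' c y z : E y -> E z -> E (c *: y + z).
      by move=> Ey Ez; have := EP c y z; rewrite !inE; apply.
    rewrite -[_ *: _]addr0; apply: (EP') => //.
    by rewrite addrC -scaleN1r; apply: (EP') => //; exact: fE.
  - exact: unit_normalize.
  - move=> z zs; rewrite (sformZl dotS) (sformC dotS) uP ?mulr0 //.
    rewrite -(nth_index 0 zs).
    by apply: (linear_span_gen f (Ordinal _)); rewrite index_mem.
have [g gP] := choice next.
(* [L n] holds the first [n] vectors, newest first; the next one is [g (L n)]. *)
pose L n := iter n (fun s => g s :: s) [::].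
have LE n : forall z, z \in L n -> E z.
  elim: n => [|n IHn] z //=; rewrite inE => /predU1P[->|/IHn//].
  by have [] := gP _ IHn.
have gL m n : (m < n)%N -> g (L m) \in L n.
  elim: n => // n IHn; rewrite ltnS leq_eqVlt inE => /predU1P[->|/IHn->].
    by rewrite eqxx.
  by rewrite orbT.
exists (fun n => g (L n)); split=> [k|i j]; first by have [] := gP _ (LE k).
have [ij|ji|->] := ltngtP i j.
- by rewrite (sformC dotS); have [_ _ ->] := gP _ (LE j) => //; exact: gL.
- by have [_ _ ->] := gP _ (LE i) => //; exact: gL.
- by rewrite dot_norm; have [_ -> _] := gP _ (LE j); rewrite expr1n.
Qed.

(** The projection is first chosen pointwise; its uniqueness then gives linearity and both values,
    and Pythagoras gives the bound. *)
Lemma projection_operator n (e : 'I_n -> H) : exists P : {linear H -> H},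
  [/\ norm_bounded_by 1 P, forall x, linear_span e x -> P x = x &
      forall x, orthogonal_complement dot (linear_span e) x -> P x = 0].
Proof.
have /choice[p pP] : forall x, exists u, linear_span e u /\
    orthogonal_complement dot (linear_span e) (x - u).
  by move=> x; have [u] := dot_projection dot_norm e x; exists u.
have uniq x u : linear_span e u ->
    orthogonal_complement dot (linear_span e) (x - u) -> p x = u.
  move=> eu xu; have [ep xp] := pP x; apply/eqP; rewrite -subr_eq0.
  have ed : linear_span e (p x - u) by exact: linear_spanB.
  apply: contrapT => /negP/(dot_pos dot_norm).
  have {2}-> : p x - u = (x - u) - (x - p x) by rewrite opprB [RHS]addrC addrA subrK.
  by rewrite (sformBr dotS) xu // xp // subr0 ltxx.
have [P PE] : exists P : {linear H -> H}, (P : H -> H) = p.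
  apply: pack_linear => c x y; have [ex xP] := pP x; have [ey yP] := pP y.
  apply: uniq => [|v ev]; first exact: linear_spanP.
  rewrite opprD addrACA -scalerBr (sformDr dotS) (sformZr dotS) xP // yP //.
  by rewrite mulr0 addr0.
exists P; rewrite PE; split=> [x|x ex|x xP].
- have [ex xP] := pP x; have := norm_add_sqr dot_norm (p x) (x - p x).
  rewrite addrC subrK xP // mulr0 addr0 => h.
  rewrite mul1r -(@ler_pXn2r _ 2) ?nnegrE // h.
  by rewrite lerDl sqr_ge0.
- by apply: uniq => // v ev; rewrite subrr (sform0r dotS).
- by apply: uniq => [|v ev]; [exact: linear_span0|rewrite subr0 xP].
Qed.

End Subspaces.

(** * The two implications of the equivalence *)

Section Main.
Context {R : realType} {H : completeNormedModType R}.
Variables (dot : {dot H for (@idfun R)}).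
Hypothesis dot_norm : forall x : H, dot x x = `|x| ^+ 2.
Let dotS := dot_symmetric_bilinear dot.
Variable T : {linear H -> H}.
Variables (K : R) (TK : norm_bounded_by K T).

Let TM : norm_bounded_by (opnorm T) T.
Proof. by move=> x; exact: opnorm_bound TK. Qed.

(** By Pythagoras, [T x0 + lambda *: A x0] is at least as long as [T x0]. *)
Lemma BJ_orthogonal_of_attained (A : {linear H -> H}) x0 :
  bounded_fun_norm A -> norm_attaining T x0 -> dot (T x0) (A x0) = 0 ->
  BJ_orthogonal T A.
Proof.
move=> /bounded_linear_norm_bounded[L _ AL] [x01 Tx0] TA lambda.
apply: le_trans (opnorm_on_ge (norm_bounded_by_addZ lambda TK AL) I x01).
rewrite -Tx0 -(@ler_pXn2r _ 2) ?nnegrE // (norm_addZ_sqr dot_norm) TA.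
by rewrite mulr0 addr0 lerDl mulr_ge0 ?sqr_ge0.
Qed.

Lemma attained_of_BJ_orthogonal (A : {linear H -> H}) (H0 : set H) :
  bounded_fun_norm A -> finite_dim_subspace H0 ->
  norm_attaining T = unit_sphere H0 ->
  opnorm_on (orthogonal_complement dot H0) T < opnorm T ->
  BJ_orthogonal T A ->
  exists2 x0, norm_attaining T x0 & dot (T x0) (A x0) = 0.
Proof.
move=> bA [H0sub [n [e H0e]]] TH0 Tlt BJ; apply: contrapT => none.
have [L L1 AL] := bounded_linear_norm_bounded bA.
have Te u : linear_span e u -> `|T u| = opnorm T * `|u|.
  have [->|u0 eu] := eqVneq u 0; first by rewrite linear0 !normr0 mulr0.
  have : unit_sphere H0 (`|u|^-1 *: u).
    by split; [rewrite H0e; exact: linear_spanZ|exact: unit_normalize].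
  rewrite -TH0 => -[_]; rewrite linearZ normrZ normfV normr_id => <-.
  by rewrite mulrC mulVKf // normr_eq0.
have Tm v : orthogonal_complement dot (linear_span e) v ->
    `|T v| <= opnorm_on (orthogonal_complement dot H0) T * `|v|.
  move=> ev; apply: (opnorm_on_bound TK); last by rewrite H0e.
  by move=> c y yP x Hx; rewrite (sformZr dotS) yP // mulr0.
have m0M : 0 <= opnorm_on (orthogonal_complement dot H0) T < opnorm T.
  by rewrite opnorm_on_ge0.
pose B x y := dot (T x) (A y) + dot (T y) (A x).
have Bne0 x : H0 x -> x != 0 -> B x x != 0.
  move=> Hx x0; apply/eqP => Bx; apply: none; exists (`|x|^-1 *: x).
    by apply: (norm_attaining_normalize TK x0); apply: Te; rewrite -H0e.
  have TA : dot (T x) (A x) = 0 by move: Bx; rewrite /B; lra.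
  by rewrite (linearZ_LR T) (linearZ_LR A) /= (sformZl dotS) (sformZr dotS) TA !mulr0.
suff [lambda] : exists lambda, opnorm (fun x => T x + lambda *: A x) < opnorm T.
  by rewrite ltNge BJ.
have [Bpos|Bneg] := form_definite_sign (symmetrized_bilinear dot T A) H0sub Bne0.
  rewrite H0e in Bpos.
  exact: (opnorm_descent dot_norm TK AL L1 Te Tm m0M Bpos).
(* A negative definite form becomes positive for [- A]; the sign is moved back into [lambda]. *)
have [A' A'E] : exists A' : {linear H -> H}, (A' : H -> H) = fun x => - A x.
  by apply: pack_linear => c x y; rewrite linearP opprD scalerN.
have A'L : norm_bounded_by L A' by move=> x; rewrite A'E normrN.
rewrite H0e in Bneg.
have [|lambda] := opnorm_descent dot_norm TK A'L L1 Te Tm m0M _.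
  move=> x ex x0; have := Bneg x ex x0.
  by rewrite A'E /B !(sformNr dotS) opprD.
by rewrite A'E => h; exists (- lambda); under eq_fun do rewrite scaleNr -scalerN.
Qed.

Hypothesis condition_a : forall A : {linear H -> H}, bounded_fun_norm A ->
  BJ_orthogonal T A -> exists2 x0, norm_attaining T x0 & dot (T x0) (A x0) = 0.

Let H0 := [set x | `|T x| = opnorm T * `|x|].

Lemma norm_attaining_sphere : norm_attaining T = unit_sphere H0.
Proof.
by apply/seteqP; split=> x [] x1 x2; split=> //; move: x1 x2;
  rewrite /H0 /= => x1 x2; rewrite ?x1 ?x2 ?mulr1 // x1 x2 mulr1.
Qed.

(** By [norm_max_dot] the cross terms also scale by [opnorm T ^+ 2], so equality of squares passes
    to linear combinations. *)
Lemma norm_attaining_subspace : submod_closed [in H0].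
Proof.
have M0 : 0 <= opnorm T by exact: opnorm_on_ge0.
split=> [|c x y]; rewrite !inE /H0 /=; first by rewrite linear0 !normr0 mulr0.
move=> Tx Ty; apply/eqP; rewrite -(@eqrXn2 _ 2) ?mulr_ge0 //; apply/eqP.
rewrite linearP addrC [c *: x + y]addrC exprMn !(norm_addZ_sqr dot_norm).
by rewrite (norm_max_dot dot_norm _ M0 TM Ty) Tx Ty !exprMn; ring.
Qed.

(* [A = T D] would be Birkhoff-James orthogonal to [T] without any witness,
   since [<T x, T D x> = |T|^2 <x, D x>] on [H0]. *)
Lemma no_degenerate_positive_operator (D : {linear H -> H}) L :
  0 < opnorm T -> 0 <= L -> norm_bounded_by L D ->
  (forall x, H0 x -> x != 0 -> 0 < dot x (D x)) ->
  ~ (forall eps, 0 < eps ->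
       exists v, [/\ `|v| = 1, opnorm T - eps < `|T v| & `|D v| <= eps]).
Proof.
move=> M0 L0 DL Dpos approx.
have TDb : norm_bounded_by (opnorm T * L) (T \o D).
  move=> x; apply: le_trans (TM _) _.
  by rewrite -mulrA ler_wpM2l // ltW.
have [|lambda|x0 Tx0] := @condition_a (T \o D).
- by apply: norm_bounded_by_fun_norm TDb; rewrite mulr_ge0 // ltW.
- apply/ler_addgt0Pr => eps eps0.
  have s0 : 0 < 1 + `|lambda| * opnorm T.
    by rewrite ltr_pwDl // mulr_ge0 // ltW.
  (* The tolerance makes the defect of [T v] and the size of [lambda *: T (D v)] total at most
     [eps]. *)
  have [|v [v1 Tv Dv]] := approx (eps / (1 + `|lambda| * opnorm T)).
    by rewrite divr_gt0.
  have := opnorm_on_ge (E := setT) (norm_bounded_by_addZ lambda TK TDb) I v1.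
  rewrite -/(opnorm _) /=.
  have h1 : `|T v| <= `|T v + lambda *: T (D v)| + `|lambda *: T (D v)|.
    by have := ler_normB (T v + lambda *: T (D v)) (lambda *: T (D v)); rewrite addrK.
  have h2 : `|lambda *: T (D v)| <=
      `|lambda| * (opnorm T * (eps / (1 + `|lambda| * opnorm T))).
    rewrite normrZ ler_wpM2l //; apply: le_trans (TM _) _.
    by rewrite ler_wpM2l // ltW.
  have h3 : eps / (1 + `|lambda| * opnorm T) +
      `|lambda| * (opnorm T * (eps / (1 + `|lambda| * opnorm T))) = eps.
    by field; rewrite gt_eqF.
  by lra.
- have [x01 _] := Tx0.
  have Hx0 : H0 x0 by move: Tx0; rewrite norm_attaining_sphere => -[].
  have x00 : x0 != 0 by rewrite -normr_gt0 x01.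
  rewrite /= (norm_max_dot dot_norm _ (ltW M0) TM Hx0) => /eqP.
  by rewrite mulf_eq0 expf_eq0 /= !gt_eqF // Dpos.
Qed.

Lemma norm_attaining_finite_dim : 0 < opnorm T -> finite_dim_subspace H0.
Proof.
move=> M0; apply: contrapT => Hinf.
have [e [eH e_on]] :=
  infinite_dim_orthonormal dot_norm norm_attaining_subspace Hinf.
(* With these weights [D (e k)] is [e k] divided by [k.+1], which tends to 0. *)
have a01 k : 0 <= 1 - (k.+1%:R^-1 : R) < 1.
  by rewrite subr_ge0 invf_le1 ?ltr0n // ler1n ltrBlDr ltrDl invr_gt0 ltr0n.
have [D [D2 De Dpos]] := diagonal_operator dot_norm e_on a01.
apply: (no_degenerate_positive_operator M0 _ D2) => // [x _|eps eps0]; first exact: Dpos.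
have [k keps] := filter_ex (near_infty_natSinv_lt (PosNum eps0)).
have ek : `|e k| = 1.
  by apply/eqP; rewrite -(@eqrXn2 _ 2) // -dot_norm e_on eqxx expr1n.
exists (e k); split=> //; first by rewrite (eH k) ek mulr1 ltrBlDr ltrDl.
rewrite De normrZ ek mulr1 subKr ger0_norm ?invr_ge0 ?ler0n //.
exact: ltW keps.
Qed.

(** Otherwise the complement contains unit vectors almost attaining [opnorm T], and the projection
    on [H0] kills them. *)
Lemma complement_opnorm_lt : 0 < opnorm T -> finite_dim_subspace H0 ->
  opnorm_on (orthogonal_complement dot H0) T < opnorm T.
Proof.
move=> M0 [_ [n [e He]]]; rewrite ltNge; apply/negP => MN.
have [P [P1 Pe Pz]] := projection_operator dot_norm e.
apply: (no_degenerate_positive_operator M0 _ P1) => // [x|eps eps0].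
  by rewrite He => /Pe ->; exact: dot_pos.
have [||v [vP v1 Tv]] :=
  @opnorm_on_approx _ _ (orthogonal_complement dot H0) T (opnorm T - eps).
- exact: lt_le_trans MN.
- by apply: lt_le_trans MN; rewrite ltrBlDr ltrDl.
by exists v; split=> //; rewrite Pz ?normr0 ?ltW // -He.
Qed.

End Main.

Unset Implicit Arguments.

(* A real Hilbert space is a complete normed space H whose norm is induced by
   an inner product dot. The hypothesis T_neq0 (T <> 0 unless H = {0}) excludes
   the zero operator on a nonzero space, for which the equivalence fails:
   (a) holds, while (b) would require 0 < 0. *)
Theorem theorem3p1 (R : realType) (H : completeNormedModType R)
    (dot : {dot H for (@idfun R)})
    (dot_norm : forall x : H, dot x x = `|x| ^+ 2)
    (T : {linear H -> H}) (T_bounded : bounded_fun_norm T)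
    (T_neq0 : (exists x : H, x != 0) -> exists x : H, T x != 0) :
  (forall A : {linear H -> H}, bounded_fun_norm A ->
     (BJ_orthogonal T A <->
      exists2 x0 : H, norm_attaining T x0 & dot (T x0) (A x0) = 0)) <->
  (exists H0 : set H,
     [/\ finite_dim_subspace H0,
         norm_attaining T = unit_sphere H0 &
         opnorm_on (orthogonal_complement dot H0) T < opnorm T]).
Proof.
have [K _ TK] := bounded_linear_norm_bounded T_bounded.
split=> [Ha|[H0 [H0fin TH0 Tlt]] A bA]; last first.
  split=> [|[x0 Tx0 TAx0]].
    exact: (attained_of_BJ_orthogonal dot_norm TK bA H0fin TH0 Tlt).
  exact: (BJ_orthogonal_of_attained dot_norm TK bA Tx0 TAx0).
have Ha' (A : {linear H -> H}) (bA : bounded_fun_norm A) := (Ha A bA).1.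
(* Testing (a) on the zero operator produces a unit vector, so [H] is nonzero and [T_neq0]
   applies. *)
have [Z ZE] : exists Z : {linear H -> H}, (Z : H -> H) = fun=> 0.
  by apply: pack_linear => c x y; rewrite scaler0 addr0.
have [||x0 [x01 _] _] := Ha' Z.
- by apply: (@norm_bounded_by_fun_norm _ _ 0) => // x; rewrite ZE normr0 mul0r.
- by move=> lambda; rewrite ZE; under [in leRHS]eq_fun do rewrite scaler0 addr0.
have M0 : 0 < opnorm T.
  have [|x Tx] := T_neq0; first by exists x0; rewrite -normr_gt0 x01.
  rewrite lt_neqAle opnorm_on_ge0 andbT eq_sym; apply: contra Tx => /eqP M0.
  by have := opnorm_bound x TK; rewrite M0 mul0r normr_le0.
exists [set x | `|T x| = opnorm T * `|x|].
have fin := norm_attaining_finite_dim dot_norm TK Ha' M0.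
split=> //; first exact: norm_attaining_sphere.
exact: (complement_opnorm_lt dot_norm TK Ha' M0 fin).
Qed.
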